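(* Let $L$ be an indexed language. Then there is an integer $l\ge 0$ such that for every $w\in L$ and every set of marked positions of $w$ containing at least $l$ positions, the following hold: (1) $w$ can be written as $w=u_1u_2\cdots u_n$ ($n\ge1$) and each $u_i$ as $u_i=v_{i,1}v_{i,2}\cdots v_{i,n_i}$; let $I=\{(i,j):1\le i\le n,\ 1\le j\le n_i\}$; (2) there is a map $\phi:I\to\{1,\dots,n\}$ such that, defining for all $t\ge0$: $v_{i,j}^{(0)}=v_{i,j}$, $u_i^{(t)}=v_{i,1}^{(t)}\cdots v_{i,n_i}^{(t)}$, $v_{i,j}^{(t+1)}=u_{\phi(i,j)}^{(t)}$, $w^{(t)}=u_1^{(t)}\cdots u_n^{(t)}$, we have $w^{(t)}\in L$ for all $t\ge 0$ (i.e. replacing each $v_{i,j}$ by $u_{\phi(i,j)}$ yields a word in $L$, and this can be iterated); (3) for every $(i,j)\in I$, if $v_{i,j}$ contains a marked position then so does $u_{\phi(i,j)}$; (4) there is $(\mathbf{i},\mathbf{j})\in I$ with $\phi(\mathbf{i},\mathbf{j})=\mathbf{i}$ such that $u_{\mathbf{i}}$ contains at least one marked position outside of the factor $v_{\mathbf{i},\mathbf{j}}$.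
   Context: Indexed languages are the languages generated by indexed grammars $G=(N,T,F,P,S)$: $N$, $T$, $F$ are finite alphabets of nonterminals, terminals and stack symbols, $S\in N$, and $P$ is a finite set of productions $A\to r$, $A\to Bf$, $Af\to r$ ($A,B\in N$, $f\in F$, $r\in(N\cup T)^*$). Sentential forms are strings over $NF^*\cup T$ ($Ax$ is a nonterminal with stack $x$, top first). For $r\in(N\cup T)^*$, $r\{x\}$ is $r$ with every nonterminal $A$ replaced by $Ax$. A step rewrites one occurrence $Ax$: by $A\to p$ into $p\{x\}$; by $A\to Bf$ into $Bfx$; if $x=fy$, by $Af\to p$ into $p\{y\}$. $L(G)$ is the set of terminal strings derivable from $S$ (with empty stack). The factors $u_i$, $v_{i,j}$ occupy contiguous blocks of positions of $w$ as given by the factorization; a factor ''contains a marked position'' if one of the positions of $w$ it occupies is marked. Factors $v_{i,j}$ may be empty. *)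

(* Defs.v *)
From Stdlib Require List.
From mathcomp Require Import all_boot.
Set Implicit Arguments. Unset Strict Implicit. Unset Printing Implicit Defensive.

Section IndexedGrammar.
Variables (N T F : finType).

(** Productions: A -> r, A -> B f, A f -> r, with r over N + T. *)
Inductive production :=
| PRule (A : N) (r : seq (N + T))
| PPush (A B : N) (f : F)
| PPop (A : N) (f : F) (r : seq (N + T)).

Record indexed_grammar := IndexedGrammar {
  ig_prods : seq production;
  ig_start : N }.

(** Symbols of sentential forms: a nonterminal with its stack (top first),
    or a terminal. *)
Inductive sym :=
| NT (A : N) (x : seq F)
| Tm (a : T).

Definition inst (r : seq (N + T)) (x : seq F) : seq sym :=
  map (fun s => match s with inl B => NT B x | inr c => Tm c end) r.

Inductive step (G : indexed_grammar) : seq sym -> seq sym -> Prop :=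
| step_rule a b A x r :
    List.In (PRule A r) (ig_prods G) ->
    step G (a ++ NT A x :: b) (a ++ inst r x ++ b)
| step_push a b A B f x :
    List.In (PPush A B f) (ig_prods G) ->
    step G (a ++ NT A x :: b) (a ++ NT B (f :: x) :: b)
| step_pop a b A f y r :
    List.In (PPop A f r) (ig_prods G) ->
    step G (a ++ NT A (f :: y) :: b) (a ++ inst r y ++ b).

Inductive derives (G : indexed_grammar) : seq sym -> seq sym -> Prop :=
| derives_refl s : derives G s s
| derives_step s1 s2 s3 : step G s1 s2 -> derives G s2 s3 -> derives G s1 s3.

Definition lang (G : indexed_grammar) (w : seq T) : Prop :=
  derives G [:: NT (ig_start G) [::]] (map Tm w).

End IndexedGrammar.

(** Factorizations: vs = [:: u_1; ...; u_n] with u_i = [:: v_{i,1}; ...; v_{i,n_i}]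
    (0-indexed in Rocq).  w = flatten (map flatten vs). *)
Section Pumping.
Variable T : Type.
Implicit Types (vs : seq (seq (seq T))) (phi : nat -> nat -> nat).

Definition n_of vs (i : nat) : nat := size (nth [::] vs i).
Definition u_of vs (i : nat) : seq T := flatten (nth [::] vs i).
Definition v_of vs (i j : nat) : seq T := nth [::] (nth [::] vs i) j.

Fixpoint u_iter vs phi (t i : nat) : seq T :=
  match t with
  | 0 => u_of vs i
  | t'.+1 => flatten [seq u_iter vs phi t' (phi i j) | j <- iota 0 (n_of vs i)]
  end.

Definition w_iter vs phi (t : nat) : seq T :=
  flatten [seq u_iter vs phi t i | i <- iota 0 (size vs)].

Definition u_start vs i : nat := size (flatten (map flatten (take i vs))).
Definition v_start vs i j : nat := u_start vs i + size (flatten (take j (nth [::] vs i))).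

Definition in_block (s len p : nat) : bool := (s <= p) && (p < s + len).
End Pumping.

(* Main.v *)
Require Import Defs.
From mathcomp Require Import all_boot.
From mathcomp Require Import zify.
(** Read a derivation as a tree and keep a marked copy of the word.  A branch that always enters the
    heaviest child meets many marked side branches.  Along it the stack goes up and down, and since
    terminals may be pretended to pop what is left of their stack, it ends at the bottom.  Splitting
    the branch as a Dyck word, whose marked steps number less than [2 ^ n] if [n] bounds the nesting,
    yields a long nested chain of levels: stacks [x_0], [x_1], ..., each [x_{i+1}] extending [x_i],
    with a node [B_i x_i] on the way up, a node [C_i x_i] on the way down, and marked letters between
    consecutive levels.  The subtree at [B_i x_i] is cut into nodes with stack exactly [x_i], each
    node of the cut at level [i+1] being cut into nodes of the cut at level [i].
    By pigeonhole two levels [x] and [y ++ x] agree on [B], on [C], and on the set of symbols, with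
    their marking, in the cut.  Repeating [y] is then the desired pumping: the factors [u_i] are the
    nodes of the inner cut, flanked by the prefix and the suffix of [w]; the [v_{i,j}] are nodes of
    the outer cut, and [phi] sends such a node to an inner one with the same symbol and marking. *)

Set Implicit Arguments. Unset Strict Implicit. Unset Printing Implicit Defensive.

(** * Derivation trees that consume the top part of the stack *)

Section PopDerivations.
Variables (N T F : finType) (G : indexed_grammar N T F).
Implicit Types (x y z : seq F) (r s t : seq (N + T)).

(* [der r y s]: whatever the stack [x] below, the symbols [r] with stack [y ++ x] derive the symbols
   [s] with stack exactly [x]; terminals are considered to carry any stack. *)
Inductive der : seq (N + T) -> seq F -> seq (N + T) -> Prop :=
| der_nil y : der [::] y [::]
| der_stop e r s : der r [::] s -> der (e :: r) [::] (e :: s)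
| der_term a r y s : der r y s -> der (inr a :: r) y (inr a :: s)
| der_rule A p r y s s' :
    List.In (PRule _ A p) (ig_prods G) -> der p y s -> der r y s' ->
    der (inl A :: r) y (s ++ s')
| der_push A B f r y s s' :
    List.In (PPush _ A B f) (ig_prods G) -> der [:: inl B] (f :: y) s ->
    der r y s' -> der (inl A :: r) y (s ++ s')
| der_pop A f p r y s s' :
    List.In (PPop A f p) (ig_prods G) -> der p y s -> der r (f :: y) s' ->
    der (inl A :: r) (f :: y) (s ++ s').

Lemma der_refl r : der r [::] r.
Proof. by elim: r => [|e r IHr]; [apply: der_nil | apply: der_stop]. Qed.

Lemma der_cat r1 r2 y s1 s2 :
  der r1 y s1 -> der r2 y s2 -> der (r1 ++ r2) y (s1 ++ s2).
Proof.
move=> d1; elim: d1 s2 r2 => {r1 y s1} //=.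
- by move=> e r s _ IH s2 r2 d2; apply: der_stop; apply: IH.
- by move=> a r y s _ IH s2 r2 d2; apply: der_term; apply: IH.
- move=> A p r y s s' hp dp _ _ IH s2 r2 d2; rewrite -catA.
  by apply: der_rule hp dp _; apply: IH.
- move=> A B f r y s s' hp dp _ _ IH s2 r2 d2; rewrite -catA.
  by apply: der_push hp dp _; apply: IH.
- move=> A f p r y s s' hp dp _ _ IH s2 r2 d2; rewrite -catA.
  by apply: der_pop hp dp _; apply: IH.
Qed.

Lemma der_cons e r y s s' : der [:: e] y s -> der r y s' -> der (e :: r) y (s ++ s').
Proof. exact: (@der_cat [:: e]). Qed.

Lemma der_cons_inv e r y u : der (e :: r) y u ->
  exists s s', [/\ u = s ++ s', der [:: e] y s & der r y s'].
Proof.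
move=> d; inversion d; subst.
- by exists [:: e], s; split=> //; apply: der_refl.
- by exists [:: inr a], s; split=> //; apply: der_term; apply: der_nil.
- exists s, s'; split=> //; rewrite -[s]cats0.
  by apply: der_rule; [eassumption | done | apply: der_nil].
- exists s, s'; split=> //; rewrite -[s]cats0.
  by apply: der_push; [eassumption | done | apply: der_nil].
- exists s, s'; split=> //; rewrite -[s]cats0.
  by apply: der_pop; [eassumption | done | apply: der_nil].
Qed.

Lemma der_nil_inv y u : der [::] y u -> u = [::].
Proof. by move=> d; inversion d. Qed.

Lemma der_cat_inv r1 r2 y u : der (r1 ++ r2) y u ->
  exists s1 s2, [/\ u = s1 ++ s2, der r1 y s1 & der r2 y s2].
Proof.
elim: r1 u => [|e r1 IH] u /= d; first by exists [::], u; split=> //; apply: der_nil.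
have [s [s' [-> d1 /IH [s1 [s2 [-> d2 d3]]]]]] := der_cons_inv d.
by exists (s ++ s1), s2; rewrite catA; split=> //; apply: der_cons.
Qed.

(** The second derivation is plugged in at the leaves made by [der_stop]. Terminals met earlier
    carry any stack, so the longer stack [y ++ z] does not disturb them. *)
Lemma der_comp r y z s t : der r y s -> der s z t -> der r (y ++ z) t.
Proof.
move=> d; elim: d t => {r y s} /=.
- by move=> y t /der_nil_inv->; apply: der_nil.
- move=> e r s _ IH t /der_cons_inv[t1 [t2 [-> d1 d2]]].
  by apply: der_cons d1 _; apply: IH.
- move=> a r y s _ IH t /der_cons_inv[t1 [t2 [-> d1 d2]]].
  suff ->: t1 = [:: inr a] by apply: der_term; apply: IH.
  by inversion d1; subst=> //; match goal with H : der [::] _ _ |- _ => rewrite (der_nil_inv H) end.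
- move=> A p r y s s' hp _ IHp _ IHr t /der_cat_inv[t1 [t2 [-> d1 d2]]].
  by apply: der_rule hp _ _; [apply: IHp | apply: IHr].
- move=> A B f r y s s' hp _ IHp _ IHr t /der_cat_inv[t1 [t2 [-> d1 d2]]].
  by apply: der_push hp _ _; [apply: IHp | apply: IHr].
- move=> A f p r y s s' hp _ IHp _ IHr t /der_cat_inv[t1 [t2 [-> d1 d2]]].
  by apply: der_pop hp _ _; [apply: IHp | apply: IHr].
Qed.

(** Converse of [der_comp]: every branch is cut where it is about to pop the first symbol of [x], or
    at its end if it never does. *)
Lemma der_split_stack r y x s : der r (y ++ x) s ->
  exists2 t, der r y t & der t x s.
Proof.
move: {-2}(y ++ x) (erefl (y ++ x)) => yx e d; elim: d y e => {r yx s}.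
- by move=> y0 y _; exists [::]; apply: der_nil.
- move=> e r s d _ [|//] /= <-.
  by exists (e :: r); [apply: der_refl | apply: der_stop].
- move=> a r y0 s d IH y /IH[t d1 d2].
  by exists (inr a :: t); apply: der_term.
- move=> A p r y0 s s' hp dp IHp dr IHr y e.
  have [t d1 d2] := IHp _ e; have [t' d1' d2'] := IHr _ e.
  by exists (t ++ t'); [apply: der_rule hp d1 d1' | apply: der_cat].
- move=> A B f r y0 s s' hp dp IHp dr IHr y e.
  have [|t d1 d2] := IHp (f :: y); first by rewrite /= e.
  have [t' d1' d2'] := IHr _ e.
  by exists (t ++ t'); [apply: der_push hp d1 d1' | apply: der_cat].
- move=> A f p r y0 s s' hp dp IHp dr IHr [|g y] /= e.
    by subst x; exists (inl A :: r); [apply: der_refl | apply: der_pop hp dp dr].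
  have [t' d1' d2'] := IHr (g :: y) e.
  case: e => eg ey; subst g; have [t d1 d2] := IHp y ey.
  by exists (t ++ t'); [apply: der_pop hp d1 d1' | apply: der_cat].
Qed.

Lemma derives_trans a b c : derives G a b -> derives G b c -> derives G a c.
Proof. by elim=> // s1 s2 s3 h _ IH /IH; apply: derives_step. Qed.

Lemma step_ctx l q a b : step G a b -> step G (l ++ a ++ q) (l ++ b ++ q).
Proof.
case=> [a' b' A x p h | a' b' A B f x h | a' b' A f y p h].
- by have := step_rule (l ++ a') (b' ++ q) x h; rewrite -!catA.
- by have := step_push (l ++ a') (b' ++ q) x h; rewrite -!catA.
- by have := step_pop (l ++ a') (b' ++ q) y h; rewrite -!catA.
Qed.

Lemma derives_ctx l q a b : derives G a b -> derives G (l ++ a ++ q) (l ++ b ++ q).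
Proof.
elim=> [s|s1 s2 s3 h _ IH]; first exact: derives_refl.
by apply: derives_step IH; apply: step_ctx.
Qed.

Lemma derives_cat a b c d : derives G a b -> derives G c d -> derives G (a ++ c) (b ++ d).
Proof.
move=> /(derives_ctx [::] c) h1 /(derives_ctx b [::]); rewrite !cats0 => h2.
exact: derives_trans h1 h2.
Qed.

Lemma der_derives r y s x : der r y s -> derives G (inst r (y ++ x)) (inst s x).
Proof.
have inst_cat s1 s2 (z : seq F) : inst (s1 ++ s2) z = inst s1 z ++ inst s2 z :> seq (sym N T F).
  exact: map_cat.
elim=> {r y s}.
- by move=> y; apply: derives_refl.
- by move=> e r s _ IH; apply: (@derives_cat [:: _] [:: _]) IH; apply: derives_refl.
- by move=> a r y s _ IH; apply: (@derives_cat [:: _] [:: _]) IH; apply: derives_refl.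
- move=> A p r y s s' h _ IH1 _ IH2; rewrite inst_cat.
  apply: (@derives_cat [:: _]) IH2; apply: derives_step IH1.
  by have := step_rule [::] [::] (y ++ x) h; rewrite cats0.
- move=> A B f r y s s' h _ IH1 _ IH2; rewrite inst_cat.
  apply: (@derives_cat [:: _]) IH2; apply: derives_step IH1.
  exact: (step_push [::] [::] (y ++ x) h).
- move=> A f p r y s s' h _ IH1 _ IH2; rewrite inst_cat.
  apply: (@derives_cat [:: _]) IH2; apply: derives_step IH1.
  by have := step_pop [::] [::] (y ++ x) h; rewrite cats0.
Qed.

(** Invariant for reading a step-by-step derivation backwards from its terminal word: each
    nonterminal of the sentential form owns a block of the word and a tree deriving it. *)
Fixpoint yields (a : seq (sym N T F)) (u : seq T) : Prop :=
  match a with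
  | [::] => u = [::]
  | Tm c :: a' => exists2 u', u = c :: u' & yields a' u'
  | NT A x :: a' => exists u1 u2,
      [/\ u = u1 ++ u2, der [:: inl A] x (map inr u1) & yields a' u2]
  end.

Lemma yields_cat a b u : yields (a ++ b) u <->
  exists u1 u2, [/\ u = u1 ++ u2, yields a u1 & yields b u2].
Proof.
elim: a u => [|[A x|c] a IH] u /=; split.
- by move=> h; exists [::], u.
- by case=> u1 [u2 [-> -> h]].
- case=> u1 [u2 [-> d /IH [u3 [u4 [-> h1 h2]]]]].
  by exists (u1 ++ u3), u4; rewrite catA; split=> //; exists u1, u3.
- case=> _ [u2 [-> [u3 [u4 [-> d h]]] h2]].
  by exists u3, (u4 ++ u2); rewrite catA; split=> //; apply/IH; exists u4, u2.
- case=> u' -> /IH [u1 [u2 [-> h1 h2]]].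
  by exists (c :: u1), u2; split=> //; exists u1.
- case=> _ [u2 [-> [u1 -> h1] h2]].
  by exists (u1 ++ u2) => //; apply/IH; exists u1, u2.
Qed.

Lemma yields_inst r x u : yields (inst r x) u -> der r x (map inr u).
Proof.
elim: r u => [|[A|c] r IH] u /=; first by move=> ->; apply: der_nil.
  by case=> u1 [u2 [-> d1 /IH d2]]; rewrite map_cat; apply: der_cons.
by case=> u' -> /IH h; apply: der_term.
Qed.

Lemma yields_step a b u : step G a b -> yields b u -> yields a u.
Proof.
case=> {a b} [a b A x p h|a b A B f x h|a b A f x p h] /yields_cat[u1 [u2 [-> h1 h2]]];
  apply/yields_cat; exists u1, u2; split=> //=.
- have /yields_cat[u3 [u4 [-> /yields_inst d h4]]] := h2.
  exists u3, u4; split=> //; rewrite -[map _ _]cats0.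
  by apply: der_rule h d _; apply: der_nil.
- case: h2 => u3 [u4 [-> d h4]]; exists u3, u4; split=> //; rewrite -[map _ _]cats0.
  by apply: der_push h d _; apply: der_nil.
- have /yields_cat[u3 [u4 [-> /yields_inst d h4]]] := h2.
  exists u3, u4; split=> //; rewrite -[map _ _]cats0.
  by apply: der_pop h d _; apply: der_nil.
Qed.

Lemma yields_terminals (w : seq T) : yields (map (@Tm N T F) w) w.
Proof. by elim: w => //= c w IH; exists w. Qed.

Lemma langP w : lang G w <-> der [:: inl (ig_start G)] [::] (map inr w).
Proof.
split; rewrite /lang => h.
  suff: yields [:: NT T (ig_start G) [::]] w by apply: (@yields_inst [:: inl _]).
  move: h; move: [:: NT _ _ _] => a; move e: (map _ w) => b h.
  elim: h e => [s <-|s1 s2 s3 st _ IH /IH]; first exact: yields_terminals.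
  exact: yields_step.
have := der_derives [::] h; rewrite /inst -map_comp /=.
by rewrite (eq_map (g := @Tm N T F)).
Qed.
End PopDerivations.

(** * Nodes with their marked words, and cuts of a tree at a given stack *)

Section Levels.
Variables (N T F : finType) (G : indexed_grammar N T F).
(** A node of the tree together with the marked word below it. Its stack is kept apart, so that
    nodes with different stacks can be compared. *)
Notation item := ((N + T) * seq (T * bool))%type.
Notation der := (der G).
Implicit Types (x y z : seq F) (B : N + T) (d : item) (c : seq item) (w : seq (T * bool)).

Definition syms c : seq (N + T) := map fst c.
Definition words c : seq (T * bool) := flatten (map snd c).
Definition marked c := has snd (words c).
Definition letters w : seq (N + T) := [seq inr p.1 | p <- w].
Definition good x d := der [:: d.1] x (letters d.2).
Definition goods x c := forall d, d \in c -> good x d.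
(* The node [d], with [y] on top of its stack, decomposes into the nodes [c] reached once [y] is
   popped. *)
Definition cuts y d c := der [:: d.1] y (syms c) /\ d.2 = words c.

Lemma syms_cat c1 c2 : syms (c1 ++ c2) = syms c1 ++ syms c2.
Proof. exact: map_cat. Qed.

Lemma words_cat c1 c2 : words (c1 ++ c2) = words c1 ++ words c2.
Proof. by rewrite /words map_cat flatten_cat. Qed.

Lemma marked_cat c1 c2 : marked (c1 ++ c2) = marked c1 || marked c2.
Proof. by rewrite /marked words_cat has_cat. Qed.

Lemma letters_cat w1 w2 : letters (w1 ++ w2) = letters w1 ++ letters w2.
Proof. exact: map_cat. Qed.

Lemma letters_cat_inv w s1 s2 : letters w = s1 ++ s2 ->
  exists w1 w2, [/\ w = w1 ++ w2, s1 = letters w1 & s2 = letters w2].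
Proof.
move=> e; exists (take (size s1) w), (drop (size s1) w).
by rewrite cat_take_drop /letters map_take map_drop -/(letters w) e take_size_cat ?drop_size_cat.
Qed.

Lemma goods_cat x c1 c2 : goods x (c1 ++ c2) <-> goods x c1 /\ goods x c2.
Proof.
split=> [h|[h1 h2] d]; last by rewrite mem_cat => /orP[/h1|/h2].
by split=> d hd; apply: h; rewrite mem_cat hd ?orbT.
Qed.

Lemma goods_cons x d c : goods x (d :: c) <-> good x d /\ goods x c.
Proof.
split=> [h|[h1 h2] e]; last by rewrite inE => /orP[/eqP->|/h2].
by split=> [|e he]; apply: h; rewrite inE ?eqxx ?he ?orbT.
Qed.

Lemma goods_der x c : goods x c -> der (syms c) x (letters (words c)).
Proof.
elim: c => [|d c IH]; first by move=> _; apply: der_nil.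
move=> /goods_cons[h1 /IH h2]; rewrite (words_cat [:: d]) letters_cat.
by apply: der_cons h2; rewrite /words /= cats0.
Qed.

Lemma der_goods r x w : der r x (letters w) ->
  exists c, [/\ syms c = r, words c = w & goods x c].
Proof.
elim: r w => [|e r IH] w.
  by move/der_nil_inv; case: w => // _; exists [::].
move/der_cons_inv => [s [s' [/letters_cat_inv[w1 [w2 [-> -> ->]]] d1 /IH[c [<- <- h]]]]].
by exists ((e, w1) :: c); split=> //; apply/goods_cons.
Qed.

Lemma cuts_exist y x d : good (y ++ x) d -> exists2 c, cuts y d c & goods x c.
Proof.
case/der_split_stack=> t d1 /der_goods[c [e1 e2 h]].
by exists c => //; split; rewrite ?e1.
Qed.

Lemma cuts_seq_exist y x c : goods (y ++ x) c ->
  exists2 S, List.Forall2 (cuts y) c S & goods x (flatten S).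
Proof.
elim: c => [|d c IH]; first by exists [::]; first exact: List.Forall2_nil.
case/goods_cons=> /cuts_exist[s h1 h2] /IH[S h3 h4].
by exists (s :: S); [apply: List.Forall2_cons | apply/goods_cat].
Qed.

Lemma cuts_refl d : cuts [::] d [:: d].
Proof. by split; [apply: der_refl | rewrite /words /= cats0]. Qed.

Lemma cuts_seq_refl c : List.Forall2 (cuts [::]) c [seq [:: d] | d <- c].
Proof. by elim: c => [|d c IH] /=; constructor=> //; apply: cuts_refl. Qed.

Lemma cuts_seq_der y c S : List.Forall2 (cuts y) c S -> der (syms c) y (syms (flatten S)).
Proof.
elim=> {c S} [|d s c S [h1 _] _ IH]; first exact: der_nil.
by rewrite /= syms_cat; apply: der_cons.
Qed.

Lemma cuts_seq_words y c S : List.Forall2 (cuts y) c S -> words (flatten S) = words c.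
Proof.
elim=> {c S} //= d s c S [_ h2] _ IH.
by rewrite words_cat IH /words /= h2.
Qed.

Lemma cuts_seq_marked y c S : List.Forall2 (cuts y) c S -> marked (flatten S) = marked c.
Proof. by rewrite /marked => /cuts_seq_words->. Qed.

Lemma cuts_seq_cat_inv y c1 c2 S : List.Forall2 (cuts y) (c1 ++ c2) S ->
  exists S1 S2, [/\ S = S1 ++ S2, List.Forall2 (cuts y) c1 S1 & List.Forall2 (cuts y) c2 S2].
Proof.
elim: c1 S => [|d c1 IH] S h; first by exists [::], S; split=> //; constructor.
inversion h; subst.
match goal with H : List.Forall2 _ (_ ++ _) _ |- _ => have [S1 [S2 [-> h1 h2]]] := IH _ H end.
by exists (y0 :: S1), S2; split=> //; constructor.
Qed.

Lemma cuts_comp y1 y2 d c S : cuts y1 d c -> List.Forall2 (cuts y2) c S ->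
  cuts (y1 ++ y2) d (flatten S).
Proof.
move=> [h1 h2] h; split; last by rewrite (cuts_seq_words h).
exact: der_comp h1 (cuts_seq_der h).
Qed.

Lemma cuts_seq_comp y1 y2 c S S' :
  List.Forall2 (cuts y1) c S -> List.Forall2 (cuts y2) (flatten S) S' ->
  exists2 S2, List.Forall2 (cuts (y1 ++ y2)) c S2 & flatten S2 = flatten S'.
Proof.
move=> h; elim: h S' => {c S} [|d s c S h _ IH] S' /=.
  by move=> h; inversion h; exists [::] => //; constructor.
case/cuts_seq_cat_inv=> S1 [S2 [-> h1 /IH[S3 h3 e]]].
exists (flatten S1 :: S3); last by rewrite /= e flatten_cat.
by constructor=> //; apply: cuts_comp h1.
Qed.

(* [up B l B' y r] says that [B], whatever the stack [z] below, derives [l], then [B'] with [y]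
   pushed on [z], then [r]. *)
Definition up B (l : seq (N + T)) B' y (r : seq (N + T)) :=
  forall z l' s r', der l z l' -> der [:: B'] (y ++ z) s -> der r z r' ->
    der [:: B] z (l' ++ s ++ r').

(* The node [top] with stack [stk] is cut into [lft], [mid], [rgt], all with stack [stk]; [mid] lies
   on the chosen branch. *)
Record level := Level {
  stk : seq F; top : N + T; lft : seq item; mid : item; rgt : seq item }.
Implicit Types k : level.

Definition cut k := lft k ++ mid k :: rgt k.
Definition valid k := der [:: top k] [::] (syms (cut k)) /\ goods (stk k) (cut k).

(* [top k' => g (top k) h] on the way up and [mid k => e (mid k') q] on the way down, where [k] has
   [y] on top of the stack of [k']. *)
Definition link b k' k := exists y g h e q SL SR,
  [/\ stk k = y ++ stk k', up (top k') (syms g) (top k) y (syms h),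
      List.Forall2 (cuts y) (lft k) SL, List.Forall2 (cuts y) (rgt k) SR &
  [/\ cuts y (mid k) (e ++ mid k' :: q),
      lft k' = g ++ flatten SL ++ e, rgt k' = q ++ flatten SR ++ h &
      b ==> marked (g ++ e ++ q ++ h)]].

Lemma link_refl k : link false k k.
Proof.
exists [::], [::], [::], [::], [::], [seq [:: d] | d <- lft k], [seq [:: d] | d <- rgt k].
split=> //; try exact: cuts_seq_refl.
  by move=> z l s r /der_nil_inv-> /= h /der_nil_inv->; rewrite cats0.
by rewrite !flatten_seq1 !cats0; split=> //; apply: cuts_refl.
Qed.

(** The side pieces of the link from [k2] to [k1] lie in [lft k2] and [rgt k2], so the other link
    cuts them further by [y2]. They then join its own side pieces. Cutting keeps the words, hence
    the marks. *)
Lemma link_trans b1 b2 k3 k2 k1 :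
  link b1 k3 k2 -> link b2 k2 k1 -> link (b1 || b2) k3 k1.
Proof.
move=> [y2 [g2 [h2 [e2 [z2 [SL2 [SR2 [es2 u2 cL2 cR2 [cm2 eL2 eR2 m2]]]]]]]]].
move=> [y1 [g1 [h1 [e1 [z1 [SL1 [SR1 [es1 u1 cL1 cR1 [cm1 eL1 eR1 m1]]]]]]]]].
move: cL2; rewrite eL1 => /cuts_seq_cat_inv[Sg [S' [eSL2 cg /cuts_seq_cat_inv[SL [Se [eS' cL ce]]]]]].
move: cR2; rewrite eR1 => /cuts_seq_cat_inv[Sz [S'' [eSR2 cz /cuts_seq_cat_inv[SR [Sh [eS'' cR ch]]]]]].
have [SL3 cL3 eL3] := cuts_seq_comp cL1 cL.
have [SR3 cR3 eR3] := cuts_seq_comp cR1 cR.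
subst S' S'' SL2 SR2.
exists (y1 ++ y2), (g2 ++ flatten Sg), (flatten Sh ++ h2), (flatten Se ++ e2), (z2 ++ flatten Sz), SL3, SR3.
split=> //; first by rewrite es1 es2 catA.
  move=> z l s r; rewrite !syms_cat -catA.
  case/der_cat_inv=> l1 [l2 [-> dl1 dl2]] ds /der_cat_inv[r1 [r2 [-> dr1 dr2]]].
  have := u2 _ _ (l2 ++ s ++ r1) _ dl1 _ dr2; rewrite -!catA; apply.
  by apply: u1 ds _; [apply: der_comp dl2 | apply: der_comp dr1]; apply: cuts_seq_der.
split.
- have h : List.Forall2 (cuts y2) (e1 ++ mid k2 :: z1) (Se ++ (e2 ++ mid k3 :: z2) :: Sz).
    by elim: ce => //= [|d s c S]; constructor.
  by have := cuts_comp cm1 h; rewrite flatten_cat /= -!catA.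
- by rewrite eL2 eL3 !flatten_cat -!catA.
- by rewrite eR2 eR3 !flatten_cat -!catA.
apply/implyP=> /orP b12; move: m1 m2; rewrite !marked_cat.
rewrite (cuts_seq_marked cg) (cuts_seq_marked ce) (cuts_seq_marked cz) (cuts_seq_marked ch).
by case: b12 => -> /=; do ![case: (marked _) => //=].
Qed.

(** * Chains of nested levels, outermost first, and the pigeonhole *)

Inductive chain : nat -> level -> Prop :=
| chain0 k : valid k -> chain 0 k
| chainS n k' k : valid k' -> link true k' k -> chain n k -> chain n.+1 k'.

(** A link that is not known to carry a mark is not counted: by transitivity it is absorbed into the
    next link of the chain. *)
Lemma chain_link (b : bool) n k' k :
  valid k' -> link b k' k -> chain n k -> chain (n + b) k'.
Proof.
move=> vk'; case: b => lk ck; first by rewrite addn1; apply: chainS lk ck.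
rewrite addn0; case: ck lk => [k0 _ _|m k1 k2 _ l12 ck lk]; first exact: chain0.
exact: chainS vk' (link_trans lk l12) ck.
Qed.

Lemma chain_levels n k : chain n k -> exists f : nat -> level,
  [/\ f 0 = k, forall i, i <= n -> valid (f i) &
      forall i j, i < j <= n -> link true (f i) (f j)].
Proof.
elim=> {n k} [k vk|n k' k vk' l' _ [f [f0 fv fl]]].
  by exists (fun=> k); split=> // i j; lia.
exists (fun i => if i is i'.+1 then f i' else k'); split=> //.
  by case.
case=> [|i] [|j] //=; last by move=> h; apply: fl; lia.
case: j => [|j] h; first by rewrite f0.
by apply: (link_trans (b1 := true) l'); rewrite -f0; apply: (fl 0 j.+1); lia.
Qed.

(** A set of symbols with markings suffices in place of the sequence, since [phi] only needs some
    inner node that resembles a given outer one. This makes the number of kinds finite. *)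
Definition kind k : (N + T) * (N + T) * {set (N + T) * bool} :=
  (top k, (mid k).1, [set p in [seq (d.1, has snd d.2) | d <- cut k]]).

Lemma chain_pigeonhole n k :
  #|{: (N + T) * (N + T) * {set (N + T) * bool}}| <= n -> chain n k ->
  exists k1 k2, [/\ valid k1, valid k2, link false k k1, link true k1 k2 & kind k1 = kind k2].
Proof.
move=> ln /chain_levels[f [f0 fv fl]].
have /injectivePn[i [j nij eij]]: ~~ injectiveb (fun i : 'I_n.+1 => kind (f i)).
  by apply/negP=> /injectiveP/leq_card; rewrite card_ord => /leq_trans/(_ ln); rewrite ltnn.
wlog lij: i j nij eij / i < j.
  move=> h; have [/h|/h|/val_inj eq_ij] := ltngtP i j; first exact.
    by apply; rewrite // eq_sym.
  by rewrite eq_ij eqxx in nij.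
have lj := ltn_ord j; have li := ltn_ord i.
exists (f i), (f j); split=> //; try (by apply: fv; lia); last by apply: fl; lia.
have [->|i_gt0] := posnP i; first by rewrite f0; apply: link_refl.
rewrite -f0; have: link true (f 0) (f i) by apply: fl; lia.
move=> [y [g [h [e [q [SL [SR [es u cL cR [cm eL eR m]]]]]]]]].
by exists y, g, h, e, q, SL, SR.
Qed.

Lemma kind_mem k1 k2 d : kind k1 = kind k2 -> d \in cut k1 ->
  exists2 d', d' \in cut k2 & d'.1 = d.1 /\ has snd d'.2 = has snd d.2.
Proof.
case=> _ _ /setP/(_ (d.1, has snd d.2)); rewrite !inE => e hd.
by move: e; rewrite map_f // => /esym/mapP[d' hd' [-> ->]]; exists d'.
Qed.

(** * Arches: stretches of the branch that stay above a fixed stack *)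

Lemma up_cut B c1 d c2 :
  der [:: B] [::] (syms (c1 ++ d :: c2)) -> up B (syms c1) d.1 [::] (syms c2).
Proof.
move=> h z l s r dl ds dr; rewrite -[z]cat0s; apply: der_comp h _.
by rewrite syms_cat; apply: der_cat dl _; apply: der_cons.
Qed.

(* The branch goes from [d] to [d'] without touching the stack [x], making [m] marked steps. *)
Definition arch x d d' m := exists L R n,
  [/\ d.2 = words (L ++ d' :: R), valid (Level x d.1 L d' R),
      chain n (Level x d.1 L d' R), m < 2 ^ n & (0 < m) ==> marked (L ++ R)].

Lemma valid_trivial x d : good x d -> valid (Level x d.1 [::] d [::]).
Proof. by split; [apply: der_refl | apply/goods_cons]. Qed.

Lemma arch_cut x d L d' R (b : bool) :
  d.2 = words (L ++ d' :: R) -> valid (Level x d.1 L d' R) -> b ==> marked (L ++ R) ->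
  arch x d d' b.
Proof.
move=> ew v hb; exists L, R, b; split=> //; last first.
- by case: (b) hb.
- by case: (b).
have [v1 v2] := v.
have gd' : good x d' by apply: v2; rewrite mem_cat inE eqxx orbT.
(* The inner level is the node [d'] alone; [L] and [R] are the side pieces of the link on the way
   up. *)
apply: (chain_link (n := 0) (k := Level x d'.1 [::] d' [::]) v).
  exists [::], L, R, [::], [::], [::], [::].
  by split=> //=; [apply: up_cut | split; rewrite ?cats0 //; apply: cuts_refl].
by apply: chain0; apply: valid_trivial.
Qed.

Lemma arch_refl x d : good x d -> arch x d d 0.
Proof.
move=> h; apply: (@arch_cut x d [::] d [::] false) => //; last exact: valid_trivial.
by rewrite /words /= cats0.
Qed.

(** The chain of the arch with more marked steps is kept, and the other arch, if it has any,
    contributes one more marked link. The sum is at most twice the larger count, so one more level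
    of nesting is enough, as for Strahler numbers. *)
Lemma arch_trans x d1 d2 d3 m1 m2 :
  arch x d1 d2 m1 -> arch x d2 d3 m2 -> arch x d1 d3 (m1 + m2).
Proof.
move=> [L1 [R1 [n1 [w1 v1 c1 l1 k1]]]] [L2 [R2 [n2 [w2 v2 c2 l2 k2]]]].
have v : valid (Level x d1.1 (L1 ++ L2) d3 (R2 ++ R1)).
  split=> /=.
    apply: (der_comp (y := [::]) (z := [::]) v1.1).
    have -> : cut (Level x d1.1 (L1 ++ L2) d3 (R2 ++ R1)) = L1 ++ (L2 ++ d3 :: R2) ++ R1.
      by rewrite /cut /= -!catA.
    rewrite (syms_cat L1 (_ ++ R1)) (syms_cat _ R1) /cut /= (syms_cat L1 (d2 :: R1)).
    by apply: der_cat (der_refl _ _) _; apply: der_cons v2.1 (der_refl _ _).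
  move: v1.2 v2.2; rewrite /cut /= => /goods_cat[h1 /goods_cons[_ h2]].
  case/goods_cat=> h3 /goods_cons[h4 h5].
  by rewrite -catA; do ![apply/goods_cat; split=> //]; apply/goods_cons; split=> //; apply/goods_cat.
(* Keeping the first chain: the second arch is passed on the way down and leaves [L2] and [R2]
   there. *)
have lk1 : link (0 < m2) (Level x d1.1 (L1 ++ L2) d3 (R2 ++ R1)) (Level x d1.1 L1 d2 R1).
  exists [::], [::], [::], L2, R2, [seq [:: d] | d <- L1], [seq [:: d] | d <- R1].
  split=> //=; try exact: cuts_seq_refl.
    by move=> z l s r /der_nil_inv-> /= h /der_nil_inv->; rewrite cats0.
  rewrite !flatten_seq1 !cats0; split=> //; split=> //.
  exact: v2.1.
(* Keeping the second chain: the first arch is passed on the way up and leaves [L1] and [R1]. *)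
have lk2 : link (0 < m1) (Level x d1.1 (L1 ++ L2) d3 (R2 ++ R1)) (Level x d2.1 L2 d3 R2).
  exists [::], L1, R1, [::], [::], [seq [:: d] | d <- L2], [seq [:: d] | d <- R2].
  split=> //=; try exact: cuts_seq_refl.
    by apply: up_cut; exact: v1.1.
  by rewrite !flatten_seq1 !cats0; split=> //; apply: cuts_refl.
have ew : d1.2 = words ((L1 ++ L2) ++ d3 :: R2 ++ R1).
  have -> : (L1 ++ L2) ++ d3 :: R2 ++ R1 = L1 ++ (L2 ++ d3 :: R2) ++ R1 by rewrite -!catA.
  by rewrite (words_cat L1 (_ ++ R1)) (words_cat _ R1) -w2 w1 (words_cat L1 (d2 :: R1)).
have em : (0 < m1 + m2) ==> marked ((L1 ++ L2) ++ R2 ++ R1).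
  move: k1 k2; rewrite !marked_cat addn_gt0.
  by case: (0 < m1); case: (0 < m2) => //=; do ![case: (marked _) => //=].
have [le12|lt21] := leqP m1 m2.
- exists (L1 ++ L2), (R2 ++ R1), (n2 + (0 < m1)); split=> //; first exact: chain_link lk2 c2.
  by case: (posnP m1) => [->|_]; rewrite ?addn0 // addn1 expnS; lia.
- exists (L1 ++ L2), (R2 ++ R1), (n1 + (0 < m2)); split=> //; first exact: chain_link lk1 c1.
  by case: (posnP m2) => [->|_]; rewrite ?addn0 // addn1 expnS; lia.
Qed.

(** A push of [f], an arch above [f :: x] and the matching pop make an arch above [x]. Its outer
    level arises by cutting [L] and [R] once more, by [f]; the pop may add one marked step, and then
    also a marked link. *)
Lemma arch_push x f A A' w d d' e q (b : bool) m :
  List.In (PPush _ A A' f) (ig_prods G) -> arch (f :: x) (inl A', w) d m ->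
  cuts [:: f] d (e ++ d' :: q) -> goods x (e ++ d' :: q) -> b ==> marked (e ++ q) ->
  arch x (inl A, w) d' (m + b).
Proof.
move=> hp [L [R [n [/= ew [/= v1 v2] c l k]]]] hc hg hb.
have /goods_cat[gL /goods_cons[_ gR]] := v2.
have [SL cL gSL] := @cuts_seq_exist [:: f] x L gL.
have [SR cR gSR] := @cuts_seq_exist [:: f] x R gR.
have u : up (inl A) [::] (inl A') [:: f] [::].
  move=> z l0 s r /der_nil_inv-> /= h /der_nil_inv->.
  by apply: der_push hp h _; apply: der_nil.
set L' := flatten SL ++ e; set R' := q ++ flatten SR.
have cLR : List.Forall2 (cuts [:: f]) (L ++ d :: R) (SL ++ (e ++ d' :: q) :: SR).
  by elim: cL => //= [|? ? ? ?]; constructor.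
have e' : flatten (SL ++ (e ++ d' :: q) :: SR) = L' ++ d' :: R'.
  by rewrite flatten_cat /= /L' /R' -!catA.
have v : valid (Level x (inl A) L' d' R').
  split=> /=.
    have h : der [:: inl A'] ([::] ++ [:: f]) (syms (L' ++ d' :: R')).
      by apply: der_comp v1 _; rewrite -e'; apply: cuts_seq_der.
    by have := u [::] [::] _ [::] (der_nil _ _) h (der_nil _ _); rewrite cats0.
  rewrite /cut /= /L' /R' -catA; apply/goods_cat; split=> //.
  by rewrite -cat_cons catA; apply/goods_cat.
exists L', R', (n + b); split=> //.
- by rewrite -e' (cuts_seq_words cLR).
- apply: chain_link c => //; exists [:: f], [::], [::], e, q, SL, SR; split=> //=.
  by rewrite /L' /R' !cats0.
- by case: (b); rewrite ?addn0 // !addn1 expnS; lia.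
- move: k hb; rewrite /L' /R' !marked_cat (cuts_seq_marked cL) (cuts_seq_marked cR) addn_gt0.
  by case: (0 < m); case: (b) => //=; do ![case: (marked _) => //=].
Qed.

(* [desc x d m] follows one branch below [d], with stack [x], down to the bottom of the stack: an
   arch above [x], the pop of the top symbol of [x], an arch above the rest of [x], and so on;
   [m] counts the marked steps of the branch. *)
Fixpoint desc x d m : Prop :=
  match x with
  | [::] => exists d', arch [::] d d' m
  | f :: x' => exists d1 d2 e q m1 (b : bool) m2,
      [/\ arch x d d1 m1, cuts [:: f] d1 (e ++ d2 :: q), goods x' (e ++ d2 :: q),
          b ==> marked (e ++ q) & desc x' d2 m2 /\ m = m1 + b + m2]
  end.

Lemma desc_arch x d1 d2 m1 m2 : arch x d1 d2 m1 -> desc x d2 m2 -> desc x d1 (m1 + m2).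
Proof.
case: x => [|f x] /= a; first by case=> d3 /(arch_trans a) h; exists d3.
case=> d3 [d4 [e [q [m3 [b [m4 [/(arch_trans a) h1 h2 h3 h4 [h5 ->]]]]]]]].
by exists d3, d4, e, q, (m1 + m3), b, m4; rewrite !addnA.
Qed.

Lemma good_term x a b : good x (inr a, [:: (a, b)]).
Proof. by apply: der_term; apply: der_nil. Qed.

(** The terminal pops its stack one symbol at a time, with trivial arches and no side pieces. *)
Lemma desc_term x a b : desc x (inr a, [:: (a, b)]) 0.
Proof.
elim: x => [|f x IH] /=.
  by exists (inr a, [:: (a, b)]); apply: arch_refl; apply: good_term.
exists (inr a, [:: (a, b)]), (inr a, [:: (a, b)]), [::], [::], 0, false, 0; split=> //.
- by apply: arch_refl; apply: good_term.
- by split=> //; apply: der_term; apply: der_nil.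
- by apply/goods_cons; split=> //; apply: good_term.
Qed.

(** * Following the heaviest child to obtain a long chain *)

Definition weight w := count snd w.

Lemma weight_gt0 w : (0 < weight w) = has snd w.
Proof. by rewrite has_count. Qed.

Lemma weight_words c : weight (words c) = sumn [seq weight d.2 | d <- c].
Proof. by elim: c => //= d c IH; rewrite (words_cat [:: d]) /weight count_cat -/(weight _) -IH /words /= cats0. Qed.

Lemma heaviest_item c : 0 < size c ->
  exists2 d, d \in c & forall d', d' \in c -> weight d'.2 <= weight d.2.
Proof.
elim: c => // d [|d0 c] IH _; first by exists d => [|d']; rewrite inE // => /eqP->.
have [//|d1 h1 h2] := IH.
have [le|lt] := leqP (weight d.2) (weight d1.2).
  by exists d1 => [|d']; rewrite inE ?h1 ?orbT // => /orP[/eqP->|/h2].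
exists d => [|d']; rewrite inE ?eqxx // => /orP[/eqP->//|/h2 h].
exact: leq_trans h (ltnW lt).
Qed.

(** A heaviest child has at least a [K]-th of the weight, and all of it when no sibling is marked.
    So the weight drops only at marked steps. *)
Lemma heavy_child K c : size c <= K -> 0 < weight (words c) ->
  exists L d R (b : bool), [/\ c = L ++ d :: R, 0 < weight d.2, b ==> marked (L ++ R) &
    weight (words c) <= K ^ b * weight d.2].
Proof.
move=> sK w_gt0; have [|d dc hd] := @heaviest_item c; first by case: (c) w_gt0.
have le_w : weight (words c) <= size c * weight d.2.
  rewrite weight_words; elim: (c) hd => //= d' c' IH hd; rewrite mulSn leq_add //.
    by apply: hd; rewrite inE eqxx.
  by apply: IH => d'' h; apply: hd; rewrite inE h orbT.
have d_gt0 : 0 < weight d.2 by case: (posnP (weight d.2)) => // e; move: le_w; rewrite e; lia.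
case/splitPr: dc sK w_gt0 le_w {hd} => L R sK w_gt0 le_w.
exists L, d, R, (marked (L ++ R)); split=> //; first exact: implybb.
case: (boolP (marked (L ++ R))) => [_|].
  by rewrite /= expn1 (leq_trans le_w) // leq_mul2r sK orbT.
rewrite marked_cat negb_or /marked -!weight_gt0 -!eqn0Ngt /= expn0 mul1n => /andP[/eqP e1 /eqP e2].
by rewrite weight_words map_cat sumn_cat /= -!weight_words e1 e2 addn0.
Qed.

(** Each marked step of the branch divides the weight by at most [K], and at a leaf the weight is at
    most 1. A rule prepends a trivial arch to the descent, a push closes an arch, and a pop opens
    the next stage of the descent. *)
Lemma der_desc K r x s w : 1 < K ->
  (forall A p, List.In (PRule _ A p) (ig_prods G) -> size p <= K) ->
  (forall A f p, List.In (PPop A f p) (ig_prods G) -> size p <= K) ->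
  der r x s -> s = letters w ->
  exists c, [/\ syms c = r, words c = w, goods x c & forall d, d \in c -> 0 < weight d.2 ->
    exists2 m, desc x d m & weight d.2 <= K ^ m].
Proof.
move=> K_gt1 hrule hpop d; elim: d w => {r x s}.
- by move=> y [|//] _; exists [::].
- move=> e r s dr IH [|[a b] w] //= [-> /IH[c [h1 h2 h3 h4]]].
  exists ((inr a, [:: (a, b)]) :: c); split=> /=; rewrite ?h1 //.
  + by rewrite /words /= -/(words c) h2.
  + by apply/goods_cons; split=> //; apply: good_term.
  + move=> d; rewrite inE => /orP[/eqP->|/h4 //] _; exists 0; first exact: (@desc_term [::]).
    by rewrite expn0 /weight /= addn0; case: (b).
- move=> a r y s dr IH [|[a' b] w] //= [<- /IH[c [h1 h2 h3 h4]]].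
  exists ((inr a, [:: (a, b)]) :: c); split=> /=; rewrite ?h1 //.
  + by rewrite /words /= -/(words c) h2.
  + by apply/goods_cons; split=> //; apply: good_term.
  + move=> d; rewrite inE => /orP[/eqP->|/h4 //] _; exists 0; first exact: desc_term.
    by rewrite expn0 /weight /= addn0; case: (b).
- move=> A p r y s s' hp dp IHp dr IHr w /esym/letters_cat_inv[w1 [w2 [-> e1 e2]]].
  have [c1 [h1 h2 h3 h4]] := IHp _ e1; have [c2 [i1 i2 i3 i4]] := IHr _ e2.
  have gA : good y (inl A, w1).
    by rewrite /good /= -e1 -[s]cats0; apply: der_rule hp dp _; apply: der_nil.
  exists ((inl A, w1) :: c2); split=> /=; rewrite ?i1 //.
  + by rewrite -i2.
  + by apply/goods_cons.
  move=> d; rewrite inE => /orP[/eqP->|/i4 //] /=; rewrite -h2 => w_gt0.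
  have [|L [d' [R [b [ec d'_gt0 hb hw]]]]] := @heavy_child K c1 _ w_gt0.
    by rewrite -(size_map fst) -/(syms c1) h1; apply: hrule hp.
  have [|m hm hK] := h4 d' _ d'_gt0; first by rewrite ec mem_cat inE eqxx orbT.
  exists (b + m); last by rewrite expnD (leq_trans hw) // leq_mul2l hK orbT.
  apply: desc_arch hm; apply: (@arch_cut _ _ L d' R) => //; first by rewrite ec.
  split; rewrite /cut /= -ec // h1 -[p]cats0.
  by apply: der_rule hp (der_refl _ _) (der_nil _ _).
- move=> A B f r y s s' hp dp IHp dr IHr w /esym/letters_cat_inv[w1 [w2 [-> e1 e2]]].
  have [c1 [h1 h2 h3 h4]] := IHp _ e1; have [c2 [i1 i2 i3 i4]] := IHr _ e2.
  have gA : good y (inl A, w1).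
    by rewrite /good /= -e1 -[s]cats0; apply: der_push hp dp _; apply: der_nil.
  exists ((inl A, w1) :: c2); split=> /=; rewrite ?i1 //.
  + by rewrite -i2.
  + by apply/goods_cons.
  move=> d; rewrite inE => /orP[/eqP->|/i4 //] /=.
  case: c1 h1 h2 {h3} h4 => [//|[B' w'] [|//]] /= [->]; rewrite /words /= cats0 => -> h4 w_gt0.
  have [|//|m] := h4 (inl B, w1); first by rewrite inE.
  (* The descent from [B] begins with an arch above [f :: y] and the pop of [f]; together with the
     push this is an arch above [y]. *)
  case=> d1 [d2 [e [q [m1 [b [m2 [a1 a2 a3 a4 [a5 em]]]]]]]] hK; exists m => //.
  by rewrite em; apply: desc_arch a5; apply: arch_push hp a1 a2 a3 a4.
- move=> A f p r y s s' hp dp IHp dr IHr w /esym/letters_cat_inv[w1 [w2 [-> e1 e2]]].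
  have [c1 [h1 h2 h3 h4]] := IHp _ e1; have [c2 [i1 i2 i3 i4]] := IHr _ e2.
  have gA : good (f :: y) (inl A, w1).
    by rewrite /good /= -e1 -[s]cats0; apply: der_pop hp dp _; apply: der_nil.
  exists ((inl A, w1) :: c2); split=> /=; rewrite ?i1 //.
  + by rewrite -i2.
  + by apply/goods_cons.
  move=> d; rewrite inE => /orP[/eqP->|/i4 //] /=; rewrite -h2 => w_gt0.
  have [|L [d' [R [b [ec d'_gt0 hb hw]]]]] := @heavy_child K c1 _ w_gt0.
    by rewrite -(size_map fst) -/(syms c1) h1; apply: hpop hp.
  have [|m hm hK] := h4 d' _ d'_gt0; first by rewrite ec mem_cat inE eqxx orbT.
  exists (b + m); last by rewrite expnD (leq_trans hw) // leq_mul2l hK orbT.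
  exists (inl A, w1), d', L, R, 0, b, m; rewrite -ec; split=> //; first by rewrite h2; apply: arch_refl.
  split=> //=; rewrite h1 -[p]cats0.
  by apply: der_pop hp (der_refl _ _) (der_nil _ _).
Qed.

Lemma long_chain n : exists l, forall w, lang G (unzip1 w) -> l <= weight w ->
  exists k, [/\ chain n k, stk k = [::], top k = inl (ig_start G) & words (cut k) = w].
Proof.
pose sz (p : production N T F) := match p with PRule _ r => size r | PPop _ _ r => size r | _ => 0 end.
(* Bounds all right-hand sides; the [.+2] gives [1 < K], which lets exponents be compared. *)
pose K := (sumn (map sz (ig_prods G))).+2.
have hK p : List.In p (ig_prods G) -> sz p <= K.
  by rewrite /K; elim: (ig_prods G) => //= q ps IH [->|/IH]; lia.
(* A weight above [K ^ 2 ^ n] forces more than [2 ^ n] marked steps, hence a nesting of at least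
   [n]. *)
exists (K ^ 2 ^ n).+1 => w /langP; rewrite -map_comp => hw lw.
have [||||c [e1 e2 _ h]] := @der_desc K _ _ _ w _ _ _ hw; rewrite //.
- by move=> A p /hK.
- by move=> A f p /hK.
case: c e1 e2 h => [//|d [|//]] /= [ed] ew h.
have dw : d.2 = w by rewrite -ew /words /= cats0.
have [||m [d' [L [R [n' [e v ch lm _]]]]] hm] := h d; [by rewrite inE | by rewrite dw; apply: leq_trans lw |].
have l_m : 2 ^ n < m by rewrite -(@ltn_exp2l K) //; apply: leq_trans lw _; rewrite -dw.
have n_n' : n <= n' by rewrite -(@leq_exp2l 2) //; lia.
exists (Level [::] d.1 L d' R); split=> //; last by rewrite -dw e.
(* The chain may be too long; innermost levels are dropped, so the outermost one stays. *)
have decr j k : chain j.+1 k -> chain j k.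
  elim: j k => [|j IH] k hk; inversion hk; subst; first exact: chain0.
  by match goal with H : link _ _ _ |- _ => apply: chainS H _ => //; apply: IH end.
by rewrite -(subnK n_n') addnC in ch; elim: (n' - n) ch => [|j IH]; rewrite ?addn0 // addnS => /decr.
Qed.
End Levels.

(** * Factorizations and [phi] stored together *)

Section Tables.
Variable T : Type.
Implicit Type tbl : seq (seq (seq T * nat)).

(* A table lists the rows of a factorization, each factor [v_{i,j}] paired with [phi i j]. *)
Definition factors_of tbl : seq (seq (seq T)) := map (map fst) tbl.
Definition phi_of tbl i j : nat := (nth ([::], 0) (nth [::] tbl i) j).2.

Lemma nth_factors tbl i : nth [::] (factors_of tbl) i = map fst (nth [::] tbl i).
Proof.
have [h|h] := ltnP i (size tbl); first by rewrite (nth_map [::]).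
by rewrite !nth_default ?size_map.
Qed.

Lemma u_iter_table tbl t i :
  u_iter (factors_of tbl) (phi_of tbl) t.+1 i =
  flatten [seq u_iter (factors_of tbl) (phi_of tbl) t pr.2 | pr <- nth [::] tbl i].
Proof.
rewrite /= /n_of nth_factors size_map; congr flatten.
by rewrite -{2}(mkseq_nth ([::], 0) (nth [::] tbl i)) /mkseq -map_comp.
Qed.
End Tables.

Lemma Forall2_size (A B : Type) (P : A -> B -> Prop) s1 s2 :
  List.Forall2 P s1 s2 -> size s2 = size s1.
Proof. by elim=> //= ? ? ? ? _ _ ->. Qed.

Lemma Forall2_nth (A B : Type) (P : A -> B -> Prop) s1 s2 a b i :
  List.Forall2 P s1 s2 -> i < size s1 -> P (nth a s1 i) (nth b s2 i).
Proof. by move=> h; elim: h i => //= x y l1 l2 h _ IH [|i] //=; apply: IH. Qed.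

Lemma Forall2_cat (A B : Type) (P : A -> B -> Prop) s1 s2 s3 s4 :
  List.Forall2 P s1 s2 -> List.Forall2 P s3 s4 -> List.Forall2 P (s1 ++ s3) (s2 ++ s4).
Proof. by move=> h1 h2; elim: h1 => //= *; constructor. Qed.

(** * Pumping between two levels of the same kind *)

Section Pump.
Variables (N T F : finType) (G : indexed_grammar N T F).
Notation item := ((N + T) * seq (T * bool))%type.
Notation der := (der G).

Lemma der_seq (c : seq item) d0 z (ps : nat -> seq (T * bool)) :
  (forall i, i < size c -> der [:: (nth d0 c i).1] z (letters N (ps i))) ->
  der (syms c) z (letters N (flatten [seq ps i | i <- iota 0 (size c)])).
Proof.
elim: c ps => [|d c IH] ps h; first exact: der_nil.
rewrite /= letters_cat; apply: der_cons; first exact: (h 0).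
rewrite (iotaDl 1 0) -map_comp; apply: IH => i; exact: (h i.+1).
Qed.

(** The desired conclusion for a word whose letters carry their marks, so that no positions need to
    be tracked. *)
Definition pumpable (w : seq (T * bool)) (tbl : seq (seq (seq (T * bool) * nat))) :=
  [/\ 0 < size tbl, w = flatten (map flatten (factors_of tbl)),
      forall r pr, r \in tbl -> pr \in r ->
        pr.2 < size tbl /\ (has snd pr.1 -> has snd (u_of (factors_of tbl) pr.2)),
      forall t, lang G (unzip1 (w_iter (factors_of tbl) (phi_of tbl) t)) &
      exists i j, [/\ i < size tbl, j < size (nth [::] tbl i), phi_of tbl i j = i &
        has snd (flatten (take j (nth [::] (factors_of tbl) i))) ||
        has snd (flatten (drop j.+1 (nth [::] (factors_of tbl) i)))]].

Section Table.
(** [k1] is the outer level, [k2] the inner one, and [y] the stack segment to be repeated; [a] and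
    [b] are the parts of the word outside the cut of [k1]. *)
Variables (k1 k2 : level N T F) (a b : seq (T * bool)) (y : seq F) (g h e q : seq item).
Variables (SL SR : seq (seq item)).
Hypotheses (v1 : valid G k1) (v2 : valid G k2) (k12 : kind k1 = kind k2).
Hypotheses (stk2 : stk k2 = y ++ stk k1) (up12 : up G (top k1) (syms g) (top k2) y (syms h)).
Hypotheses (cL : List.Forall2 (cuts G y) (lft k2) SL) (cR : List.Forall2 (cuts G y) (rgt k2) SR).
Hypothesis cm : cuts G y (mid k2) (e ++ mid k1 :: q).
Hypotheses (lft1 : lft k1 = g ++ flatten SL ++ e) (rgt1 : rgt k1 = q ++ flatten SR ++ h).
Hypothesis mk : marked (g ++ e ++ q ++ h).
Hypothesis start : forall s, der [:: top k1] (stk k1) s ->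
  der [:: inl (ig_start G)] [::] (letters N a ++ s ++ letters N b).

Let D := cut k2.
Let p := size D.
Let i0 := size (lft k2).
Let S := SL ++ (e ++ mid k1 :: q) :: SR.
(** The shift by one leaves row 0 to the prefix of the word. *)
Let target (d : item) := (find (fun d' : item => (d'.1 == d.1) && (has snd d'.2 == has snd d.2)) D).+1.
Let row (c : seq item) := [seq (d.2, target d) | d <- c].
(** One row for each node of the inner cut, listing its pieces in the outer cut. The piece [mid k1]
    is sent to its own row instead of its [target], to make a fixed point. *)
Let rows := map row SL ++ (row e ++ ((mid k1).2, i0.+1) :: row q) :: map row SR.
(** [a] and [b] are sent to their own rows, so the first and last rows accumulate one more layer of
    [g] and [h] in each round. *)
Let tbl := ((a, 0) :: row g) :: rcons rows (rcons (row h) (b, p.+1)).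
Let vs := factors_of tbl.
Let phi := phi_of tbl.
Let d0 : item := mid k2.

Lemma cuts_inner : List.Forall2 (cuts G y) D S.
Proof. by rewrite /D /S /cut; elim: cL => //= [|? ? ? ?]; constructor. Qed.

Lemma outer_cutE : cut k1 = g ++ flatten S ++ h.
Proof. by rewrite /cut lft1 rgt1 /S flatten_cat /= -!catA. Qed.

Lemma size_pieces : size S = p.
Proof. exact: Forall2_size cuts_inner. Qed.

Lemma size_rows : size rows = p.
Proof. by rewrite -size_pieces /rows /S !size_cat /= !size_map. Qed.

Lemma size_tbl : size tbl = p.+2.
Proof. by rewrite /= size_rcons size_rows. Qed.

Lemma i0_lt : i0 < p.
Proof. by rewrite /p /D /cut size_cat /= /i0; lia. Qed.

Lemma nth_i0 : nth d0 D i0 = mid k2.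
Proof. by rewrite /D /cut nth_cat /i0 ltnn subnn. Qed.

Lemma targetP d : d \in cut k1 -> exists i,
  [/\ target d = i.+1, i < p, (nth d0 D i).1 = d.1 & has snd (nth d0 D i).2 = has snd d.2].
Proof.
move=> /(kind_mem k12)[d' hd' [h1 h2]].
have hh : has (fun d' : item => (d'.1 == d.1) && (has snd d'.2 == has snd d.2)) D.
  by apply/hasP; exists d' => //; rewrite h1 h2 !eqxx.
exists (find (fun d' : item => (d'.1 == d.1) && (has snd d'.2 == has snd d.2)) D).
by split; rewrite ?/p -?has_find //; have /andP[/eqP ? /eqP ?] := nth_find d0 hh.
Qed.

Lemma row_words c : flatten (map fst (row c)) = words c.
Proof. by rewrite /row -map_comp. Qed.

(** Markings are left out, as [mid k1] is sent to [mid k2], which is only known to have the same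
    symbol. *)
Definition entry (d : item) (pr : seq (T * bool) * nat) :=
  pr.1 = d.2 /\ exists i, [/\ pr.2 = i.+1, i < p & (nth d0 D i).1 = d.1].

Lemma row_entry c : {subset c <= cut k1} -> List.Forall2 entry c (row c).
Proof.
elim: c => [|d c IH] hc; constructor; last by apply: IH => d' hd'; apply: hc; rewrite inE hd' orbT.
split=> //=; have [|i [h1 h2 h3 _]] := @targetP d; first by apply: hc; rewrite inE eqxx.
by exists i.
Qed.

Lemma sub_left : {subset g <= cut k1}.
Proof. by move=> d hd; rewrite outer_cutE !mem_cat hd. Qed.

Lemma sub_right : {subset h <= cut k1}.
Proof. by move=> d hd; rewrite outer_cutE !mem_cat hd !orbT. Qed.

Lemma sub_pieces s : s \in S -> {subset s <= cut k1}.
Proof.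
move=> hs d hd; rewrite outer_cutE !mem_cat; apply/orP; right; apply/orP; left.
by apply/flattenP; exists s.
Qed.

Lemma rows_entry : List.Forall2 (List.Forall2 entry) S rows.
Proof.
have sub_row SX : {subset SX <= S} -> List.Forall2 (List.Forall2 entry) SX (map row SX).
  elim: SX => [|s SX IH] hs; constructor; last by apply: IH => d' hd'; apply: hs; rewrite inE hd' orbT.
  by apply: row_entry; apply: sub_pieces; apply: hs; rewrite inE eqxx.
apply: Forall2_cat; first by apply: sub_row => s hs; rewrite /S mem_cat hs.
constructor; last by apply: sub_row => s hs; rewrite /S mem_cat inE hs !orbT.
have hm : e ++ mid k1 :: q \in S by rewrite /S mem_cat inE eqxx orbT.
apply: Forall2_cat.
  by apply: row_entry => d hd; apply: (sub_pieces hm); rewrite mem_cat hd.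
constructor; last by apply: row_entry => d hd; apply: (sub_pieces hm); rewrite mem_cat inE hd !orbT.
split=> //=; exists i0; split; rewrite ?i0_lt // nth_i0.
by case: k12.
Qed.

Lemma entry_words c r : List.Forall2 entry c r -> flatten (map fst r) = words c.
Proof. by elim=> //= d pr c' r' [-> _] _ ->. Qed.

Lemma nth_row0 : nth [::] tbl 0 = (a, 0) :: row g.
Proof. by []. Qed.

Lemma nth_rowS i : i < p -> nth [::] tbl i.+1 = nth [::] rows i.
Proof. by move=> hi; rewrite /= nth_rcons size_rows hi. Qed.

Lemma nth_row_last : nth [::] tbl p.+1 = rcons (row h) (b, p.+1).
Proof. by rewrite /= nth_rcons size_rows ltnn eqxx. Qed.

Lemma u_ofS i : i < p -> u_of vs i.+1 = (nth d0 D i).2.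
Proof.
move=> hi; rewrite /u_of /vs nth_factors nth_rowS //.
have hS : i < size S by rewrite size_pieces.
rewrite (entry_words (Forall2_nth [::] [::] rows_entry hS)).
by have [_ ->] := Forall2_nth d0 [::] cuts_inner hi.
Qed.

Let U t i := u_iter vs phi t i.
(** The stack at the turning point of round [t]: that of [k2] with [t] further copies of [y]. *)
Let Z t := iter t (cat y) (stk k2).

Lemma der_entries t c r :
  (forall i, i < p -> der [:: (nth d0 D i).1] (Z t) (letters N (U t i.+1))) ->
  List.Forall2 entry c r ->
  der (syms c) (Z t) (letters N (flatten [seq U t pr.2 | pr <- r])).
Proof.
move=> hU; elim=> [|d pr c' r' [_ [i [ei hi hd]]] _ IH] /=; first exact: der_nil.
by rewrite ei letters_cat; apply: der_cons => //; rewrite -hd; apply: hU.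
Qed.

(** Popping the top copy of [y] turns an inner node into the pieces of its row. Each piece may
    derive whatever its image under [phi] derives, as both have the same symbol. *)
Lemma der_U t i : i < p -> der [:: (nth d0 D i).1] (Z t) (letters N (U t i.+1)).
Proof.
elim: t i => [|t IH] i hi.
  by rewrite /U /= u_ofS //; apply: v2.2; apply: mem_nth.
have hS : i < size S by rewrite size_pieces.
rewrite /U u_iter_table nth_rowS //.
have [hc _] := Forall2_nth d0 [::] cuts_inner hi.
apply: der_comp hc _; apply: der_entries; first exact: IH.
exact: Forall2_nth rows_entry hS.
Qed.

(** Since [top k1] equals [top k2], the ascent from [k1] to [k2] can be repeated, each time pushing
    [y] and adding the layers [g] and [h]. *)
Lemma der_start t s : der [:: top k2] (Z t) s ->
  der [:: inl (ig_start G)] [::] (letters N (U t 0) ++ s ++ letters N (U t p.+1)).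
Proof.
elim: t s => [|t IH] s hs.
  have [_] := v1; rewrite outer_cutE => /goods_cat[gg /goods_cat[_ gh]].
  rewrite /U /= /u_of /vs !nth_factors nth_row0 nth_row_last map_rcons flatten_rcons /=.
  rewrite !row_words !letters_cat -!catA.
  have := start (s := letters N (words g) ++ s ++ letters N (words h)); rewrite -!catA; apply.
  by apply: up12; [apply: goods_der | rewrite -stk2 | apply: goods_der].
rewrite /U !u_iter_table nth_row0 nth_row_last map_rcons flatten_rcons /= !letters_cat -!catA.
set l := letters N (flatten [seq _ | pr <- row g]).
set r := letters N (flatten [seq _ | pr <- row h]).
have := IH (l ++ s ++ r); rewrite -!catA; apply.
have e12 : top k1 = top k2 by case: k12.
rewrite -e12; apply: up12 => //; apply: der_entries; try exact: der_U.
  exact: row_entry sub_left.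
exact: row_entry sub_right.
Qed.

Lemma lang_w_iter t : lang G (unzip1 (w_iter vs phi t)).
Proof.
apply/langP; rewrite -map_comp.
(* At the turning point [top k2] splits into the inner cut without touching the stack; then [der_U]
   applies to each node. *)
have hB : der [:: top k2] ([::] ++ Z t) (letters N (flatten [seq U t i.+1 | i <- iota 0 p])).
  by apply: der_comp v2.1 _; apply: (@der_seq _ d0 _ (fun i => U t i.+1)) => i; apply: der_U.
have eI : iota 0 p.+2 = 0 :: map succn (iota 0 p) ++ [:: p.+1].
  by rewrite -(iotaDl 1 0) -[iota 0 p.+2]/(0 :: iota 1 p.+1) -(addn1 p) iotaD add1n addn1.
have -> : w_iter vs phi t = U t 0 ++ flatten [seq U t i.+1 | i <- iota 0 p] ++ U t p.+1.
  by rewrite /w_iter size_map size_tbl eI /= map_cat flatten_cat /= cats0 -map_comp.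
by have := der_start hB; rewrite -!letters_cat.
Qed.

Lemma table_words : flatten (map flatten vs) = a ++ words (cut k1) ++ b.
Proof.
have -> : words (cut k1) = words g ++ flatten (map flatten (factors_of rows)) ++ words h.
  rewrite outer_cutE !words_cat; congr (_ ++ (_ ++ _)).
  by elim: rows_entry => //= s r S' rs hs _ IH; rewrite words_cat (entry_words hs) IH.
by rewrite /vs /tbl /factors_of /= !map_rcons !flatten_rcons !row_words -!catA.
Qed.

Lemma u_of_last : u_of vs p.+1 = words h ++ b.
Proof. by rewrite /u_of nth_factors nth_row_last map_rcons flatten_rcons row_words. Qed.

Lemma table_entries r pr : r \in tbl -> pr \in r ->
  pr.2 < size tbl /\ (has snd pr.1 -> has snd (u_of vs pr.2)).
Proof.
rewrite size_tbl.
have row_ok c pr' : {subset c <= cut k1} -> pr' \in row c ->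
  pr'.2 < p.+2 /\ (has snd pr'.1 -> has snd (u_of vs pr'.2)).
  move=> hc /mapP[d /hc hd -> /=]; have [i [-> hi _ hm]] := targetP hd.
  by rewrite u_ofS // hm; split=> //; lia.
rewrite inE => /orP[/eqP->|].
  rewrite inE => /orP[/eqP-> /=|/row_ok]; last by apply; apply: sub_left.
  by split=> // ha; rewrite /u_of /= has_cat ha.
rewrite mem_rcons inE => /orP[/eqP->|].
  rewrite mem_rcons inE => /orP[/eqP-> /=|/row_ok]; last by apply; apply: sub_right.
  by split=> // hb; rewrite u_of_last has_cat hb orbT.
have sub_row SX : {subset SX <= S} -> r \in map row SX -> pr \in r ->
    pr.2 < p.+2 /\ (has snd pr.1 -> has snd (u_of vs pr.2)).
  by move=> hs /mapP[s /hs/sub_pieces hs' ->]; apply: row_ok.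
rewrite mem_cat => /orP[|].
  by apply: sub_row => s hs; rewrite /S mem_cat hs.
rewrite inE => /orP[/eqP->|]; last first.
  by apply: sub_row => s hs; rewrite /S mem_cat inE hs !orbT.
have hm : e ++ mid k1 :: q \in S by rewrite /S mem_cat inE eqxx orbT.
rewrite mem_cat inE => /or3P[/row_ok|/eqP->|/row_ok].
- by apply=> d hd; apply: (sub_pieces hm); rewrite mem_cat hd.
(* [mid k1] is one of the pieces of [mid k2], so a mark in it is also a mark in [mid k2]. *)
- rewrite /= u_ofS ?i0_lt // nth_i0; split; first by have := i0_lt; lia.
  by move=> hh; have [_ ->] := cm; rewrite words_cat has_cat has_cat hh orbT.
- by apply=> d hd; apply: (sub_pieces hm); rewrite mem_cat inE hd !orbT.
Qed.

(** The three entries sent to their own rows are [a], [mid k1] and [b]; beside them stand [g], then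
    [e] and [q], then [h]. The marked link puts a mark into one of these. *)
Lemma table_self : exists i j,
  [/\ i < size tbl, j < size (nth [::] tbl i), phi i j = i &
      has snd (flatten (take j (nth [::] vs i))) || has snd (flatten (drop j.+1 (nth [::] vs i)))].
Proof.
have nth_mid : nth [::] tbl i0.+1 = row e ++ ((mid k1).2, i0.+1) :: row q.
  rewrite nth_rowS ?i0_lt // nth_cat size_map (Forall2_size cL) ltnn subnn //.
have mid_case : marked e || marked q -> exists i j,
  [/\ i < size tbl, j < size (nth [::] tbl i), phi i j = i &
      has snd (flatten (take j (nth [::] vs i))) || has snd (flatten (drop j.+1 (nth [::] vs i)))].
  move=> m; exists i0.+1, (size e); rewrite size_tbl /phi /phi_of /vs nth_factors nth_mid.
  have se : size (row e) = size e by apply: size_map.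
  split; first by have := i0_lt; lia.
  - by rewrite size_cat se /=; lia.
  - by rewrite nth_cat se ltnn subnn.
  rewrite map_cat take_size_cat ?size_map // drop_cat !size_map ltnNge leqnSn subSnn.
  by rewrite /= drop0 !row_words.
move: mk; rewrite !marked_cat => /or4P[mg|me|mq|mh].
- by exists 0, 0; split=> //; rewrite /= drop0 row_words -/(marked g) mg.
- by apply: mid_case; rewrite me.
- by apply: mid_case; rewrite mq orbT.
exists p.+1, (size h); rewrite size_tbl /phi /phi_of /vs nth_factors nth_row_last.
have sh : size (row h) = size h by apply: size_map.
split=> //; first by rewrite size_rcons sh.
  by rewrite nth_rcons sh ltnn eqxx.
by rewrite map_rcons -cats1 take_size_cat ?size_map // row_words -/(marked h) mh.
Qed.

Lemma table_pumpable : pumpable (a ++ words (cut k1) ++ b) tbl.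
Proof.
split=> //; [by rewrite -table_words | exact: table_entries | exact: lang_w_iter | exact: table_self].
Qed.
End Table.

Lemma marked_pumping : exists l, forall w : seq (T * bool),
  lang G (unzip1 w) -> l <= weight w ->
  exists tbl, pumpable w tbl.
Proof.
(* A chain with as many links as there are kinds has one level more than there are kinds. *)
have [l hl] := long_chain G #|{: (N + T) * (N + T) * {set (N + T) * bool}}|.
exists l => w hw /(hl _ hw)[k [ck sk tk <-]].
have [k1 [k2 [v1 v2 l01 l12 k12]]] := chain_pigeonhole (leqnn _) ck.
have vk : valid G k by inversion ck.
case: l01 => y0 [g0 [h0 [e0 [q0 [SL0 [SR0 [s0 u0 cL0 cR0 [cm0 eL0 eR0 _]]]]]]]].
case: l12 => y [g [h [e [q [SL [SR [s u cL cR [cm eL eR m]]]]]]]].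
have ew : words (cut k) = words g0 ++ words (cut k1) ++ words h0.
  have wc c1 (d : item) c2 : words (c1 ++ d :: c2) = words c1 ++ d.2 ++ words c2.
    by rewrite words_cat.
  rewrite /cut !wc eL0 eR0 !words_cat (cuts_seq_words cL0) (cuts_seq_words cR0).
  by rewrite cm0.2 wc -!catA.
(* The level [k] starts at the root with empty stack, so its link to [k1] gives the context around
   [k1]. *)
have start t : der [:: top k1] (stk k1) t ->
    der [:: inl (ig_start G)] [::] (letters N (words g0) ++ t ++ letters N (words h0)).
  have [_] := vk; rewrite sk /cut eL0 eR0 -cat1s -!catA => /goods_cat[gg /goods_cat[_ /goods_cat[_]]].
  move=> /goods_cat[_ /goods_cat[_ /goods_cat[_ gh]]] dt.
  by rewrite -tk; apply: u0; [apply: goods_der | rewrite -sk -s0 | apply: goods_der].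
by rewrite ew; eexists; apply: (table_pumpable v1 v2 k12 s u cL cR cm eL eR m start).
Qed.
End Pump.

(** * Erasing the marks commutes with all the pumping operations *)

Section MapFactors.
Variables (A B : Type) (f : A -> B).
Implicit Type vs : seq (seq (seq A)).

Definition map_factors vs : seq (seq (seq B)) := map (map (map f)) vs.

Lemma nth_map_factors vs i : nth [::] (map_factors vs) i = map (map f) (nth [::] vs i).
Proof.
have [h|h] := ltnP i (size vs); first by rewrite (nth_map [::]).
by rewrite !nth_default ?size_map.
Qed.

Lemma flatten_map_factors vs :
  flatten (map flatten (map_factors vs)) = map f (flatten (map flatten vs)).
Proof.
rewrite map_flatten -!map_comp; congr flatten.
by apply: eq_map => s /=; rewrite map_flatten.
Qed.

Lemma n_of_map vs i : n_of (map_factors vs) i = n_of vs i.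
Proof. by rewrite /n_of nth_map_factors size_map. Qed.

Lemma u_of_map vs i : u_of (map_factors vs) i = map f (u_of vs i).
Proof. by rewrite /u_of nth_map_factors map_flatten. Qed.

Lemma v_of_map vs i j : v_of (map_factors vs) i j = map f (v_of vs i j).
Proof.
rewrite /v_of nth_map_factors; set s := nth [::] vs i.
have [h|h] := ltnP j (size s); first by rewrite (nth_map [::]).
by rewrite !nth_default ?size_map.
Qed.

Lemma u_start_map vs i : u_start (map_factors vs) i = u_start vs i.
Proof. by rewrite /u_start /map_factors -map_take flatten_map_factors size_map. Qed.

Lemma v_start_map vs i j : v_start (map_factors vs) i j = v_start vs i j.
Proof. by rewrite /v_start u_start_map nth_map_factors -map_take -map_flatten size_map. Qed.

Lemma u_iter_map vs phi t i : u_iter (map_factors vs) phi t i = map f (u_iter vs phi t i).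
Proof.
elim: t i => [|t IH] i /=; first exact: u_of_map.
by rewrite n_of_map map_flatten -map_comp; congr flatten; apply: eq_map => j /=.
Qed.

Lemma w_iter_map vs phi t : w_iter (map_factors vs) phi t = map f (w_iter vs phi t).
Proof.
rewrite /w_iter size_map map_flatten -map_comp; congr flatten.
by apply: eq_map => i /=; rewrite u_iter_map.
Qed.
End MapFactors.

(** * Translating between marked positions and marked letters *)

Section Marks.
Variables (T : Type) (w : seq T) (M : {set 'I_(size w)}).

Definition mark : seq (T * bool) := [seq (tnth (in_tuple w) i, i \in M) | i <- enum 'I_(size w)].

Lemma unzip1_mark : unzip1 mark = w.
Proof. by rewrite /unzip1 -map_comp; apply: (map_tnth_enum (in_tuple w)). Qed.

Lemma size_mark : size mark = size w.
Proof. by rewrite size_map size_enum_ord. Qed.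

Lemma count_mark : count snd mark = #|M|.
Proof. by rewrite count_map enumT cardE /enum_mem size_filter; apply: eq_count. Qed.

Lemma nth_mark (p : 'I_(size w)) : nth false (map snd mark) p = (p \in M).
Proof. by rewrite -map_comp (nth_map p) ?size_enum_ord // nth_ord_enum. Qed.

Lemma exists_marked pre blk post : mark = pre ++ blk ++ post ->
  [exists p in M, in_block (size pre) (size blk) p] = has snd blk.
Proof.
move=> e.
have nth_blk k : k < size blk ->
    nth false (map snd blk) k = nth false (map snd mark) (size pre + k).
  move=> hk; rewrite e !map_cat !nth_cat !size_map.
  by rewrite ltnNge leq_addr /= addKn hk.
have -> : has snd blk = has id (map snd blk) by rewrite has_map.
apply/exists_inP/(has_nthP false); rewrite size_map.
  case=> p pM /andP[h1 h2]; exists (p - size pre); first by lia.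
  by rewrite nth_blk ?subnKC ?nth_mark //; lia.
case=> k hk; rewrite nth_blk // => hm.
have hp : size pre + k < size w by rewrite -size_mark e !size_cat; lia.
by exists (Ordinal hp); [rewrite -nth_mark | rewrite /in_block /=; lia].
Qed.
End Marks.

Lemma factors_split (T : Type) (vs : seq (seq (seq T))) i : i < size vs ->
  flatten (map flatten vs) =
  flatten (map flatten (take i vs)) ++ u_of vs i ++ flatten (map flatten (drop i.+1 vs)).
Proof.
move=> hi; rewrite -{1}(cat_take_drop i vs) (drop_nth [::] hi).
by rewrite map_cat flatten_cat.
Qed.

Lemma u_of_split (T : Type) (vs : seq (seq (seq T))) i j : j < n_of vs i ->
  u_of vs i =
  flatten (take j (nth [::] vs i)) ++ v_of vs i j ++ flatten (drop j.+1 (nth [::] vs i)).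
Proof.
move=> hj; rewrite /u_of -{1}(cat_take_drop j (nth [::] vs i)) (drop_nth [::] hj).
by rewrite flatten_cat.
Qed.

Theorem theorem1 (N T F : finType) (G : indexed_grammar N T F) :
  exists l : nat,
  forall (w : seq T), lang G w ->
  forall (M : {set 'I_(size w)}), l <= #|M| ->
  exists (vs : seq (seq (seq T))) (phi : nat -> nat -> nat),
    [/\ (* (1) *) 0 < size vs /\ w = flatten (map flatten vs),
        (* phi : I -> {1..n} *)
        (forall i j, i < size vs -> j < n_of vs i -> phi i j < size vs),
        (* (2) *) (forall t, lang G (w_iter vs phi t)),
        (* (3) *)
        (forall i j, i < size vs -> j < n_of vs i ->
           [exists p in M, in_block (v_start vs i j) (size (v_of vs i j)) p] ->
           [exists p in M, in_block (u_start vs (phi i j)) (size (u_of vs (phi i j))) p])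
      & (* (4) *)
        exists i j, [/\ i < size vs, j < n_of vs i, phi i j = i &
          [exists p in M, in_block (u_start vs i) (size (u_of vs i)) p &&
                          ~~ in_block (v_start vs i j) (size (v_of vs i j)) p]]].
Proof.
have [l hl] := marked_pumping G.
exists l => w hw M hM.
have [||tbl [tbl_gt0 ew entries langs [i0 [j0 [hi0 hj0 phi0 m0]]]]] := hl (mark M).
- by rewrite unzip1_mark.
- by rewrite /weight count_mark.
set vs := factors_of tbl in ew entries langs m0.
set phi := phi_of tbl in langs phi0.
have size_vs : size vs = size tbl by rewrite size_map.
have n_vs i : n_of vs i = size (nth [::] tbl i) by rewrite /n_of nth_factors size_map.
have u_marked i : i < size vs ->
    [exists p in M, in_block (u_start vs i) (size (u_of vs i)) p] = has snd (u_of vs i).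
  by move=> hi; apply: exists_marked; rewrite ew (factors_split hi).
have u_cut i j : i < size vs -> j < n_of vs i -> exists post,
    mark M = flatten (map flatten (take i vs)) ++ flatten (take j (nth [::] vs i)) ++
             v_of vs i j ++ flatten (drop j.+1 (nth [::] vs i)) ++ post.
  move=> hi hj; exists (flatten (map flatten (drop i.+1 vs))).
  by rewrite ew (factors_split hi) (u_of_split hj) -!catA.
have v_marked i j : i < size vs -> j < n_of vs i ->
    [exists p in M, in_block (v_start vs i j) (size (v_of vs i j)) p] = has snd (v_of vs i j).
  move=> hi hj; have [post e] := u_cut _ _ hi hj.
  by rewrite /v_start /u_start -size_cat; apply: exists_marked; rewrite e -!catA; reflexivity.
have entry i j : i < size vs -> j < n_of vs i ->
    phi i j < size tbl /\ (has snd (v_of vs i j) -> has snd (u_of vs (phi i j))).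
  rewrite size_vs n_vs => hi hj.
  have -> : v_of vs i j = (nth ([::], 0) (nth [::] tbl i) j).1.
    by rewrite /v_of nth_factors (nth_map ([::], 0)).
  by apply: (entries (nth [::] tbl i)); apply: mem_nth.
exists (map_factors fst vs), phi; rewrite size_map; split.
- by rewrite size_vs flatten_map_factors -ew -/(unzip1 _) unzip1_mark.
- by move=> i j hi; rewrite n_of_map size_vs => hj; case: (entry i j hi hj).
- by move=> t; rewrite w_iter_map; apply: langs.
- move=> i j hi; rewrite n_of_map => hj.
  have [h1 h2] := entry i j hi hj.
  by rewrite v_start_map u_start_map v_of_map u_of_map !size_map v_marked // u_marked ?size_vs.
have hi : i0 < size vs by rewrite size_vs.
have hj : j0 < n_of vs i0 by rewrite n_vs.
exists i0, j0; rewrite n_of_map; split=> //.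
rewrite v_start_map u_start_map v_of_map u_of_map !size_map (u_of_split hj) !size_cat.
have [post e] := u_cut _ _ hi hj.
(* The mark lies in [u] either before or after the factor [v]; [exists_marked] is applied to that
   block, which is disjoint from [v]. *)
case/orP: m0 => m0.
  have := exists_marked e; rewrite m0 => /exists_inP[p pM hp]; apply/exists_inP; exists p => //.
  by move: hp; rewrite /v_start /in_block -/(u_start vs i0); lia.
have e' : mark M = (flatten (map flatten (take i0 vs)) ++ flatten (take j0 (nth [::] vs i0)) ++
    v_of vs i0 j0) ++ flatten (drop j0.+1 (nth [::] vs i0)) ++ post by rewrite e -!catA.
have := exists_marked e'; rewrite m0 => /exists_inP[p pM hp]; apply/exists_inP; exists p => //.
by move: hp; rewrite /v_start /in_block !size_cat -/(u_start vs i0); lia.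
Qed.
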